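(* Let $F\in C^3(\mathbb{R}^d)$, $f=\nabla F$, and let $M:[0,\infty)\to\mathbb{R}^{d\times d}$ be a matrix function. Assume: (a) there exist $R_0>0$, $C_F>0$ such that $-\nabla F(x)\cdot x\ge C_F|x|^2$ whenever $|x|\ge R_0$; (b) $x'=f(x)$ has a finite number of equilibria, all hyperbolic, whose stable and unstable manifolds intersect transversally; (c) $A\in C^1([0,\infty);\mathbb{R}^{d\times d})$, $A(s)$ is symmetric positive definite for every $s\ge 0$, and for constants $C_A,\overline{D_A},\overline{D_M}>0$: $\left(\frac{dA(s)}{ds}u,u\right)\le -C_A(A(s)u,u)$ for a.e. $s>0$ and all $u\in\mathbb{R}^d$; $\lambda_{\max}(A(s))\le\overline{D_A}^2\lambda_{\min}(A(s))$ and $\|M(s)\|\le\overline{D_M}^2\lambda_{\min}(A(s))$ for all $s\ge0$; and $\int_0^\infty M(s)\,ds$ is symmetric. Then there exist $\varepsilon_0>0$ and $R>0$ such that for every $\varepsilon\in[0,\varepsilon_0)$ the following holds: if $e\in\mathbb{R}^d$ is an equilibrium of $x'=f(x)$ with an isolating block with cones $N^x$, then the semiflow $S^\varepsilon$ has an equilibrium $(0,e^\varepsilon)$ which is the unique equilibrium of $S^\varepsilon$ in the set $\widetilde N^x=\{\eta\in L^2_A(\mathbb{R}^+)^d:\|\eta\|\le R\}\times N^x$. Moreover, these points $(0,e^\varepsilon)$ (with $e$ ranging over the equilibria of $x'=f(x)$) are the only equilibria of $S^\varepsilon$.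
   Context: $|\cdot|$ and $(\cdot,\cdot)$ are the Euclidean norm and inner product, $\|\cdot\|$ of a matrix is the operator norm, $\lambda_{\min},\lambda_{\max}$ are the extreme eigenvalues of a symmetric matrix. $L^2_A(\mathbb{R}^+)^d$ is the space of $\eta:[0,\infty)\to\mathbb{R}^d$ with $\|\eta\|^2=\int_0^\infty(A(s)\eta(s),\eta(s))\,ds<\infty$. Semiflow $S^\varepsilon(t)$ on $L^2_A(\mathbb{R}^+)^d\times\mathbb{R}^d$: $S^\varepsilon(t)(\eta^0,x_0)=(\eta^t,x(t))$, where $x(0)=x_0$ and $x$ solves $x'(t)=f(x(t))+\varepsilon\left(\int_0^\infty M(s)\,ds\right)x(t)+\varepsilon\int_0^\infty M(s)\eta^t(s)\,ds$ for $t\ge 0$, with $\eta^t(s)=x(t-s)-x(t)$ for $0\le s\le t$ and $\eta^t(s)=x_0+\eta^0(s-t)-x(t)$ for $s>t$. An equilibrium of $S^\varepsilon$ is a point fixed by $S^\varepsilon(t)$ for all $t\ge0$. An isolating block with cones of an equilibrium $e$ of $x'=f(x)$ is a set $N\ni e$ that is both an isolating block and an h-set with cones for the semiflow $S(t)$ of $x'=f(x)$ on $\mathbb{R}^d$, in the following sense. Write $d=u+s$, $u=u_1+2u_2$, $s=s_1+2s_2$. An h-set is a set $N=\Lambda(N_u\times N_s)$ with $\Lambda:\mathbb{R}^{u}\times\mathbb{R}^s\to\mathbb{R}^d$ an affine bijection and $N_u=\prod_{k\le u_1}[-a_k,a_k]\times\prod_{k\le u_2}\{z\in\mathbb{R}^2:|z|\le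 b_k\}$, $N_s$ defined analogously with $s_1$ intervals and $s_2$ discs (all half-lengths and radii positive). $N$ is an isolating block if there are $\epsilon>0$, $t_\epsilon>0$ such that for all $\tau\in(0,t_\epsilon]$: $S(\tau)N\subset\Lambda(N_{u,\epsilon}\times N_s)$, where $N_{u,\epsilon}$ is $N_u$ with all $a_k,b_k$ increased by $\epsilon$, and $S(\tau)(\Lambda(\partial N_u\times N_s))\cap N=\emptyset$. $N$ is an h-set with cones if there are positive definite quadratic forms $\alpha$ on $\mathbb{R}^u$, $\beta$ on $\mathbb{R}^s$ such that for all $x_1\ne x_2$ in $N$ the function $t\mapsto\alpha(P_uS(t)x_1-P_uS(t)x_2)-\beta(P_sS(t)x_1-P_sS(t)x_2)$ is strictly increasing as long as both $S(t)x_1$, $S(t)x_2$ stay in $N$, where $(P_ux,P_sx)=\Lambda^{-1}(x)$.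
   Formalization: The equilibrium e is required to lie in the interior of its block N^x (not merely in N^x), and one block N^x per equilibrium is fixed before ε_0 and R are chosen, so ε_0 and R may depend on the blocks; M is assumed measurable. *)

(* Defs.v *)
From mathcomp Require Import all_boot all_order all_algebra.
From mathcomp Require Import all_classical all_reals all_analysis.
From mathcomp Require Import complex.

Set Implicit Arguments.
Unset Strict Implicit.
Unset Printing Implicit Defensive.

Import Order.TTheory GRing.Theory Num.Theory.
Import numFieldNormedType.Exports.

Local Open Scope classical_set_scope.
Local Open Scope ring_scope.

Section Euclidean.
Context {R : realType}.

(* The norm `|x| that the library puts on matrices is the sup norm; it defines
   the same topology, but the estimates below are Euclidean. *)
Definition dot n (x y : 'cV[R]_n) : R := \sum_i x i 0 * y i 0.

Definition enorm n (x : 'cV[R]_n) : R := Num.sqrt (dot x x).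

Definition opnorm n (P : 'M[R]_n) : R :=
  sup [set enorm (P *m x) | x in [set x : 'cV[R]_n | enorm x <= 1]].

Definition lambda_min n (P : 'M[R]_n) : R := inf [set a | eigenvalue P a].

Definition lambda_max n (P : 'M[R]_n) : R := sup [set a | eigenvalue P a].

Definition posdef n (P : 'M[R]_n) : Prop :=
  P^T = P /\ forall x : 'cV[R]_n, x <> 0 -> 0 < dot (P *m x) x.

End Euclidean.

Section Calculus.
Context {R : realType}.

Definition halfline : set R := `[0, +oo[.

(* C^k through continuous partial derivatives up to order k *)
Fixpoint Ck (k : nat) n (F : 'cV[R]_n -> R) : Prop :=
  continuous F /\
  if k is k'.+1 then
    forall i : 'I_n, (forall x, derivable F x (delta_mx i 0)) /\
                     Ck k' (fun x => 'D_(delta_mx i 0) F x)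
  else True.

Definition grad n (F : 'cV[R]_n -> R) (x : 'cV[R]_n) : 'cV[R]_n :=
  \col_i 'D_(delta_mx i 0) F x.

Definition Jac n (f : 'cV[R]_n -> 'cV[R]_n) (x : 'cV[R]_n) : 'M[R]_n :=
  \matrix_(i, j) ('D_(delta_mx j 0) f x) i 0.

(* v is the derivative at t of z restricted to D, hence a one-sided derivative
   at an end-point of an interval D *)
Definition deriv_within (V : normedModType R) (D : set R) (z : R -> V) (t : R)
    (v : V) : Prop :=
  (fun s : R => (s - t)^-1 *: (z s - z t)) @ within D (t^') --> v.

Definition C1_halfline (V : normedModType R) (g : R -> V) : Prop :=
  exists dg : R -> V, {within halfline, continuous dg} /\
    forall s, 0 <= s -> deriv_within halfline g s (dg s).

Definition mxint m n (g : R -> 'M[R]_(m, n)) : 'M[R]_(m, n) :=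
  \matrix_(i, j) \int[@lebesgue_measure R]_(s in halfline) g s i j.

Definition mxmeasurable m n (g : R -> 'M[R]_(m, n)) : Prop :=
  forall i j, measurable_fun halfline (fun s => g s i j).

End Calculus.

Section Flow.
Context {R : realType} {d : nat}.
Implicit Types (f : 'cV[R]_d -> 'cV[R]_d) (e x y : 'cV[R]_d).

Definition trajectory (D : set R) f (z : R -> 'cV[R]_d) : Prop :=
  forall t, D t -> deriv_within D z t (f (z t)).

(* S(t)x = y, where S is the semiflow of x' = f(x) *)
Definition flow f (t : R) x y : Prop :=
  exists z, [/\ trajectory halfline f z, z 0 = x & z t = y].

Definition flow_image f (t : R) (B : set 'cV[R]_d) : set 'cV[R]_d :=
  [set y | exists2 x, B x & flow f t x y].

Definition hyperbolic f e : Prop :=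
  forall a : R[i], eigenvalue (map_mx (real_complex R) (Jac f e)) a ->
    complex.Re a <> 0.

Definition stable_manifold f e : set 'cV[R]_d :=
  [set x | exists z, [/\ trajectory halfline f z, z 0 = x &
                         z t @[t --> +oo] --> e]].

Definition unstable_manifold f e : set 'cV[R]_d :=
  [set x | exists z, [/\ trajectory `]-oo, 0] f z, z 0 = x &
                         z t @[t --> -oo] --> e]].

(* T_x W, as the set of velocities at x of C^1 curves lying in W. It is the usual
   tangent space when W is an embedded submanifold, as are the stable and
   unstable manifolds of the hyperbolic equilibria of a gradient system. *)
Definition tangent_space (W : set 'cV[R]_d) x : set 'cV[R]_d :=
  [set v | exists g : R -> 'cV[R]_d,
    [/\ g 0 = x, derive1 g 0 = v &
      \forall t \near (0 : R), [/\ W (g t), derivable g t 1 &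
                                   {for t, continuous (derive1 g)}]]].

Definition meet_transversally (V W : set 'cV[R]_d) : Prop :=
  forall x, V x -> W x -> forall w : 'cV[R]_d,
    exists v1 v2, [/\ tangent_space V x v1, tangent_space W x v2 &
                      w = v1 + v2].

End Flow.

Section Blocks.
Context {R : realType}.

(* A product of n1 intervals and n2 discs in R^(n1 + 2 n2). The two coordinates
   of the k-th disc have index n1 + k and n1 + n2 + k. *)
Definition hbox n1 n2 (a : 'I_n1 -> R) (b : 'I_n2 -> R) :
    set 'cV[R]_(n1 + (n2 + n2)) :=
  [set z | (forall k, `|z (lshift (n2 + n2) k) 0| <= a k) /\
    (forall k, Num.sqrt (z (rshift n1 (lshift n2 k)) 0 ^+ 2 +
                         z (rshift n1 (rshift n2 k)) 0 ^+ 2) <= b k)].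

(* The affine bijection Lambda is (p, q) |-> hL (p; q) + hc. That hL has a
   two-sided inverse forces d = u + s. *)
Record hset (d : nat) := HSet {
  hu1 : nat; hu2 : nat; hs1 : nat; hs2 : nat;
  ha_u : 'I_hu1 -> R; hb_u : 'I_hu2 -> R;
  ha_s : 'I_hs1 -> R; hb_s : 'I_hs2 -> R;
  ha_u_gt0 : forall k, 0 < ha_u k; hb_u_gt0 : forall k, 0 < hb_u k;
  ha_s_gt0 : forall k, 0 < ha_s k; hb_s_gt0 : forall k, 0 < hb_s k;
  hL : 'M[R]_(d, (hu1 + (hu2 + hu2)) + (hs1 + (hs2 + hs2)));
  hLinv : 'M[R]_((hu1 + (hu2 + hu2)) + (hs1 + (hs2 + hs2)), d);
  hLK : hLinv *m hL = 1%:M;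
  hLinvK : hL *m hLinv = 1%:M;
  hc : 'cV[R]_d }.

Section HSet.
Context {d : nat} (H : hset d).

Definition udim := (hu1 H + (hu2 H + hu2 H))%N.
Definition sdim := (hs1 H + (hs2 H + hs2 H))%N.

Definition Lambda (p : 'cV[R]_udim) (q : 'cV[R]_sdim) : 'cV[R]_d :=
  hL H *m col_mx p q + hc H.

Definition P_u (x : 'cV[R]_d) : 'cV[R]_udim := usubmx (hLinv H *m (x - hc H)).

Definition P_s (x : 'cV[R]_d) : 'cV[R]_sdim := dsubmx (hLinv H *m (x - hc H)).

Definition N_u : set 'cV[R]_udim := hbox (@ha_u d H) (@hb_u d H).

Definition N_u_eps (eps : R) : set 'cV[R]_udim :=
  hbox (fun k => ha_u k + eps) (fun k => hb_u k + eps).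

Definition N_s : set 'cV[R]_sdim := hbox (@ha_s d H) (@hb_s d H).

Definition hprod (B : set 'cV[R]_udim) (C : set 'cV[R]_sdim) : set 'cV[R]_d :=
  [set x | exists p q, [/\ B p, C q & x = Lambda p q]].

Definition hset_set : set 'cV[R]_d := hprod N_u N_s.

Definition isolating_block (f : 'cV[R]_d -> 'cV[R]_d) : Prop :=
  exists eps teps : R, [/\ 0 < eps, 0 < teps &
    forall tau, 0 < tau <= teps ->
      flow_image f tau hset_set `<=` hprod (N_u_eps eps) N_s /\
      flow_image f tau (hprod (closure N_u `\` interior N_u) N_s) `&` hset_set
        = set0].

Definition satisfies_cones (f : 'cV[R]_d -> 'cV[R]_d) : Prop :=
  exists (alpha : 'M[R]_udim) (beta : 'M[R]_sdim),
    [/\ posdef alpha, posdef beta &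
    forall z1 z2 : R -> 'cV[R]_d,
      trajectory halfline f z1 -> trajectory halfline f z2 ->
      z1 0 <> z2 0 ->
      let V t := let p := P_u (z1 t) - P_u (z2 t) in
                 let q := P_s (z1 t) - P_s (z2 t) in
                 dot (alpha *m p) p - dot (beta *m q) q in
      forall t1 t2, 0 <= t1 -> t1 < t2 ->
        (forall t, 0 <= t <= t2 -> hset_set (z1 t) /\ hset_set (z2 t)) ->
        V t1 < V t2].

End HSet.

(* The equilibrium has to be interior to the block, not merely a point of it:
   [1, 2] has all the other properties for x' = 1 - x, but the equilibrium of
   x' = 1 - x - eps * x leaves [1, 2] for every eps > 0. *)
Definition isolating_block_with_cones d (f : 'cV[R]_d -> 'cV[R]_d)
    (e : 'cV[R]_d) (N : set 'cV[R]_d) : Prop :=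
  exists H : hset d, [/\ N = hset_set H, interior N e,
    isolating_block H f & satisfies_cones H f].

End Blocks.

Section Memory.
Context {R : realType} {d : nat}.
Implicit Types (A M : R -> 'M[R]_d) (f : 'cV[R]_d -> 'cV[R]_d).
Implicit Types (eta : R -> 'cV[R]_d).

(* Elements of L^2_A are represented by functions; only the values on
   [0, +oo[ matter, and states are compared up to almost everywhere equality. *)
Definition L2A A eta : Prop :=
  mxmeasurable eta /\
  (\int[@lebesgue_measure R]_(s in halfline)
      (dot (A s *m eta s) (eta s))%:E < +oo)%E.

Definition L2A_norm A eta : R :=
  Num.sqrt (\int[@lebesgue_measure R]_(s in halfline)
              dot (A s *m eta s) (eta s)).

Definition state : Type := ((R -> 'cV[R]_d) * 'cV[R]_d)%type.

Definition state_eq (p q : state) : Prop :=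
  {ae @lebesgue_measure R, forall s, 0 <= s -> p.1 s = q.1 s} /\ p.2 = q.2.

Definition history (p : state) (x : R -> 'cV[R]_d) (t s : R) : 'cV[R]_d :=
  if s <= t then x (t - s) - x t else p.2 + p.1 (s - t) - x t.

Definition memory_solution f M (eps : R) (p : state) (x : R -> 'cV[R]_d)
    : Prop :=
  x 0 = p.2 /\
  forall t, 0 <= t -> deriv_within halfline x t
    (f (x t) + eps *: (mxint M *m x t)
     + eps *: mxint (fun s => M s *m history p x t s)).

(* S^eps(t)p = q *)
Definition memory_semiflow f M (eps t : R) (p q : state) : Prop :=
  exists x, memory_solution f M eps p x /\ state_eq q (history p x t, x t).

Definition memory_equilibrium f A M (eps : R) (p : state) : Prop :=
  L2A A p.1 /\ forall t, 0 <= t -> memory_semiflow f M eps t p p.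

Definition ball_times A (rad : R) (N : set 'cV[R]_d) : set state :=
  [set p | [/\ L2A A p.1, L2A_norm A p.1 <= rad & N p.2]].

Definition zero_history (x : 'cV[R]_d) : state := (fun=> 0, x).

End Memory.

(* Main.v *)
(* An equilibrium (eta, x0) of the semiflow carries, for every horizon t > 0, a
   solution x_t with x_t(0) = x_t(t) = x0 and eta(s) = x_t(t - s) - x0 for almost
   every s <= t. Comparing two horizons shows that the solutions are constant, so
   eta = 0 and the equilibria are the points (0, x) with
   f(x) + eps * B x = 0, where B is the integral of M. Hyperbolicity makes Df(e)
   invertible, so a Newton-type contraction gives exactly one such x in a small
   ball around each equilibrium e of f; coercivity and compactness exclude
   any other one when eps is small. Two equilibria in one block would contradict
   the cone condition, so a block is disjoint from the small balls around the other
   equilibria, and contains the ball around its own. *)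
Require Import Defs.
From mathcomp Require Import all_boot all_order all_algebra.
From mathcomp Require Import all_classical all_reals all_analysis.
From mathcomp Require Import measurable_realfun complex ring lra.
Set Implicit Arguments.
Unset Strict Implicit.
Unset Printing Implicit Defensive.

Import Order.TTheory GRing.Theory Num.Theory.
Import numFieldNormedType.Exports.
Local Open Scope classical_set_scope.
Local Open Scope ring_scope.

(** * Column vectors with the sup norm *)

Section ColumnVectors.
Context {R : realType}.

Lemma normr_coord n (x : 'cV[R]_n) i : `|x i 0| <= `|x|.
Proof.
rewrite [leRHS]/Num.Def.normr /= mx_normrE.
exact: (le_bigmax _ (fun ij : 'I_n * 'I_1 => `|x ij.1 ij.2|) (i, 0)).
Qed.

Lemma normr_col_le n (x : 'cV[R]_n) (c : R) :
  0 <= c -> (forall i, `|x i 0| <= c) -> `|x| <= c.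
Proof.
move=> c0 xc; rewrite /Num.Def.normr /= mx_normrE (bigmax_le _ c0)//= => -[i j] _ /=.
by rewrite ord1.
Qed.

Lemma mulmx_norm_bound m n (P : 'M[R]_(m, n)) :
  exists2 K : R, 0 < K & forall x : 'cV[R]_n, `|P *m x| <= K * `|x|.
Proof.
(* The summand 1 keeps the constant positive even for the zero matrix, so that it can be
   inverted. *)
exists (1 + \sum_i \sum_j `|P i j|).
  by rewrite ltr_pwDl// sumr_ge0// => i _; rewrite sumr_ge0.
have P0 i : 0 <= \sum_j `|P i j| by rewrite sumr_ge0.
move=> x; apply: normr_col_le => [|i].
  by rewrite mulr_ge0// addr_ge0// sumr_ge0.
rewrite mxE (le_trans (ler_norm_sum _ _ _))//.
apply: (@le_trans _ _ (\sum_j `|P i j| * `|x|)).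
  by apply: ler_sum => j _; rewrite normrM ler_wpM2l// normr_coord.
rewrite -mulr_suml ler_wpM2r// (bigD1 i)//= addrCA lerDl addr_ge0//.
by rewrite sumr_ge0.
Qed.

Lemma cvg_col (T : Type) (G : set_system T) n (f : T -> 'cV[R]_n) (l : 'cV[R]_n) :
  Filter G -> (forall i, f x i 0 @[x --> G] --> l i 0) -> f x @[x --> G] --> l.
Proof.
move=> FG fl; apply/cvgrPdist_le => e e0.
have : \forall x \near G, forall i, `|l i 0 - f x i 0| <= e.
  by apply: filter_forall => i; move/cvgrPdist_le : (fl i); exact.
by apply: filterS => x fx; apply: normr_col_le (ltW e0) _ => i; rewrite !mxE.
Qed.

Lemma lipschitz_continuous (V W : normedModType R) (f : V -> W) (K : R) :
  0 < K -> (forall x y, `|f x - f y| <= K * `|x - y|) -> continuous f.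
Proof.
move=> K0 fK x; apply/(@cvgrPdist_le _ _ _ (nbhs x)) => e e0; near=> y.
rewrite (le_trans (fK _ _))// -ler_pdivlMl//.
near: y; apply/(nbhs_ballP x); exists (K^-1 * e) => [|y].
  by rewrite /= mulr_gt0// invr_gt0.
by rewrite -ball_normE => /ltW.
Unshelve. all: by end_near. Qed.

Lemma mulmx_continuous m n (P : 'M[R]_(m, n)) :
  continuous (fun x : 'cV[R]_n => P *m x).
Proof.
have [K K0 PK] := mulmx_norm_bound P.
by apply: (lipschitz_continuous K0) => x y; rewrite -mulmxBr.
Qed.

Lemma closed_le_fun (T : topologicalType) (g : T -> R) (c : R) :
  continuous g -> closed [set x | g x <= c].
Proof.
move=> gc; apply: (@preimage_closed _ _ g [set y | y <= c]) => [x _|].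
  exact: gc.
exact: closed_le.
Qed.

(** Heine-Borel for columns, carried over from row vectors by transposition, which is continuous in
    the sup norm. *)
Lemma compact_col n (A : set 'cV[R]_n) (c : R) :
  closed A -> (forall x, A x -> `|x| <= c) -> compact A.
Proof.
move=> Acl Ac.
have trc m k : continuous (trmx : 'M[R]_(m, k) -> 'M[R]_(k, m)).
  move=> x; apply/(@cvgrPdist_lt _ _ _ (nbhs x)) => e e0; near=> y.
  have : ball x e y by near: y; exact: nbhsx_ballx.
  case=> _ xy; suff : ball x^T e y^T by rewrite -ball_normE.
  by split => // i j; rewrite !mxE.
have -> : A = trmx @` [set v : 'rV[R]_n | A v^T].
  apply/seteqP; split=> [x Ax|_ [v Av <-]//].
  by exists x^T; rewrite /= trmxK.
apply: continuous_compact; first exact/continuous_subspaceT/trc.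
apply: bounded_closed_compact; last first.
  by apply: (@preimage_closed _ _ trmx A) => // x _; exact: trc.
exists c; split; first exact: num_real.
move=> M cM v /= /Ac /le_trans; move=> /(_ M (ltW cM)) => vM.
have M0 : 0 <= M by rewrite (le_trans _ vM).
rewrite /Num.Def.normr /= mx_normrE (bigmax_le _ M0)//= => -[i j] _ /=.
by rewrite ord1 (le_trans _ vM)//; have := normr_coord v^T j; rewrite mxE.
Unshelve. all: by end_near. Qed.

Lemma compact_col_ball n (e : 'cV[R]_n) (r : R) :
  compact [set x | `|x - e| <= r].
Proof.
apply: (@compact_col _ _ (r + `|e|)).
  apply: closed_le_fun; apply: (lipschitz_continuous ltr01) => x y.
  by rewrite mul1r (le_trans (ler_dist_dist _ _))// opprB addrA subrK.
by move=> x /= xr; rewrite -[x](subrK e) (le_trans (ler_normD _ _))// lerD2r.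
Qed.

End ColumnVectors.

(** * Strict differentiability *)

Section MeanValue.
Context {R : realType}.

(** The two difference quotients are the same function of the increment. This reduces estimates
    along a line to the one-variable mean value theorem. *)
Lemma is_derive_line (V W : normedModType R) (h : V -> W) (p v : V) (s : R) :
  derivable h (p + s *: v) v ->
  is_derive s 1 (fun t : R => h (p + t *: v)) ('D_v h (p + s *: v)).
Proof.
have E : (fun a : R => a^-1 *: (h (p + (a *: 1 + s) *: v) - h (p + s *: v))) =
         (fun a : R => a^-1 *: (h (a *: v + (p + s *: v)) - h (p + s *: v))).
  apply/funext => a; congr (_ *: (h _ - _)).
  by rewrite -[a *: 1]/(a * 1) mulr1 scalerDl addrCA.
move=> hv; apply: DeriveDef; first by rewrite /derivable /= E.
by rewrite /derive /= E.
Qed.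

Lemma mean_value_line (V : normedModType R) (h : V -> R) (p v : V) (a b c : R) :
  a <= b -> (forall s, a <= s <= b -> derivable h (p + s *: v) v) ->
  (forall s, a <= s <= b -> `|'D_v h (p + s *: v)| <= c) ->
  `|h (p + b *: v) - h (p + a *: v)| <= c * (b - a).
Proof.
move=> ab hv hc.
have D s : a <= s <= b ->
    is_derive s 1 (fun t : R => h (p + t *: v)) ('D_v h (p + s *: v)).
  by move=> sab; apply/is_derive_line/hv.
have [||s sab ->] := @MVT_segment _ (fun t : R => h (p + t *: v))
    (fun t => 'D_v h (p + t *: v)) _ _ ab.
- by move=> s; rewrite in_itv /= => /andP[/ltW ? /ltW ?]; apply/D/andP.
- apply: derivable_within_continuous => s; rewrite in_itv /= => /D sD.
  exact: ex_derive.
by rewrite normrM (@ger0_norm _ (b - a)) ?subr_ge0// ler_wpM2r ?subr_ge0// hc//.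
Qed.

(** Only partial derivatives are available, so the path from [y] to [x] changes one coordinate at a
    time. A sup-norm ball is a box, hence the path stays in it; each of the [n] legs costs at most
    [c] times the distance of [x] and [y]. *)
Lemma mean_value_box n (h : 'cV[R]_n -> R) (e : 'cV[R]_n) (r c : R) :
  (forall x j, derivable h x (delta_mx j 0)) ->
  (forall x j, `|x - e| <= r -> `|'D_(delta_mx j 0) h x| <= c) ->
  forall x y, `|x - e| <= r -> `|y - e| <= r ->
  `|h x - h y| <= n%:R * c * `|x - y|.
Proof.
move=> hv hc x y xr yr.
have r0 : 0 <= r by rewrite (le_trans _ xr).
have coord z i : `|z - e| <= r -> `|z i 0 - e i 0| <= r.
  by move=> zr; have := normr_coord (z - e) i; rewrite !mxE => /le_trans; apply.
(* The corner of the path reached after [k] legs. *)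
pose z k : 'cV[R]_n := \col_i if (i < k)%N then x i 0 else y i 0.
have zr k : `|z k - e| <= r.
  by apply: normr_col_le => // i; rewrite !mxE; case: ifP => _; exact: coord.
have z0 : z 0%N = y by apply/colP => i; rewrite !mxE ltn0.
have zn : z n = x by apply/colP => i; rewrite !mxE ltn_ord.
suff step k : (k <= n)%N -> `|h (z k) - h y| <= k%:R * c * `|x - y|.
  by rewrite -{1}zn step.
elim: k => [|k IH] kn; first by rewrite z0 subrr normr0 !mul0r.
rewrite -(subrKA (h (z k))) (le_trans (ler_normD _ _))//.
rewrite -natr1 mulrDl mulrDl mul1r addrC lerD ?IH ?(ltnW kn)//.
pose i := Ordinal kn.
(* With coordinate [i] cleared, [p] is the base point of the line that contains both [z k] and
   [z k.+1]. *)
pose p : 'cV[R]_n := \col_j if j == i then 0 else z k j 0.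
have pE t : p + t *: delta_mx i 0 = \col_j if j == i then t else z k j 0.
  apply/colP => j; rewrite !mxE eqxx andbT.
  by case: eqP => _; rewrite ?mulr1 ?mulr0 ?add0r ?addr0.
have zk : z k = p + y i 0 *: delta_mx i 0.
  by rewrite pE; apply/colP => j; rewrite !mxE; case: eqP => // ->; rewrite ltnn.
have zk1 : z k.+1 = p + x i 0 *: delta_mx i 0.
  rewrite pE; apply/colP => j; rewrite !mxE ltnS leq_eqVlt.
  by rewrite -[(j : nat) == k]/(j == i); case: eqP => [->|].
have key (u v : R) : u <= v -> `|u - e i 0| <= r -> `|v - e i 0| <= r ->
    `|h (p + v *: delta_mx i 0) - h (p + u *: delta_mx i 0)| <= c * (v - u).
  move=> uv ur vr; apply: mean_value_line => // s suv; apply: hc.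
  rewrite pE; apply: normr_col_le => // j; rewrite !mxE; case: eqP => [->|_].
    move: suv ur vr; rewrite !ler_norml; lra.
  by case: ifP => _; exact: coord.
have xyi : `|x i 0 - y i 0| <= `|x - y|.
  by have := normr_coord (x - y) i; rewrite !mxE.
have c0 : 0 <= c by rewrite (le_trans _ (hc x i xr)).
rewrite zk zk1 (@le_trans _ _ (c * `|x i 0 - y i 0|)) ?ler_wpM2l//.
have [yx|/ltW xy] := leP (y i 0) (x i 0).
  by rewrite (@ger0_norm _ (_ i 0 - _)) ?subr_ge0// key ?coord.
by rewrite distrC (distrC (x i 0)) (@ger0_norm _ (_ i 0 - _)) ?subr_ge0// key ?coord.
Qed.

Lemma is_derive_mulmx m n (P : 'M[R]_(m, n)) (i : 'I_m) (j : 'I_n) (z : 'cV[R]_n) :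
  is_derive z (delta_mx j 0) (fun z => (P *m z) i 0) (P i j).
Proof.
have PE a : a != 0 -> a^-1 *: ((P *m (a *: delta_mx j 0 + z)) i 0 - (P *m z) i 0)
    = P i j.
  move=> a0; rewrite mulmxDr -scalemxAr -colE !mxE addrK.
  by rewrite -[_ *: _]/(_ * _) mulKf.
have lim : (fun a : R => a^-1 *: ((P *m (a *: delta_mx j 0 + z)) i 0 -
    (P *m z) i 0)) a @[a --> 0^'] --> P i j.
  apply: cvg_near_cst; near=> a; apply: PE; near: a; exact: nbhs_dnbhs_neq.
by apply: DeriveDef; [apply/cvg_ex; exists (P i j)|exact: cvg_lim lim].
Unshelve. all: by end_near. Qed.

(** Each coordinate of [f] minus its linear part at [e] has partial derivatives that vanish at [e]
    and are continuous there, hence are small on a ball around [e]; the mean value estimate on that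
    ball does the rest. *)
Lemma strict_derivative n (f : 'cV[R]_n -> 'cV[R]_n) (e : 'cV[R]_n) (c : R) :
  (forall i j x, derivable (fun x => f x i 0) x (delta_mx j 0)) ->
  (forall i j, {for e, continuous (fun x => 'D_(delta_mx j 0) (fun x => f x i 0) x)}) ->
  0 < c -> exists2 r, 0 < r & forall x y, `|x - e| <= r -> `|y - e| <= r ->
    `|f x - f y - Jac f e *m (x - y)| <= c * `|x - y|.
Proof.
move=> fd fc c0.
have JE i j : Jac f e i j = 'D_(delta_mx j 0) (fun x => f x i 0) e.
  rewrite mxE derive_mx ?mxE//; apply/derivable_mxP => k l.
  by rewrite ord1.
(* The mean value estimate multiplies the bound by [n]; dividing by [n.+1] absorbs this factor and
   is safe for [n = 0]. *)
pose c' := c / n.+1%:R; have c'0 : 0 < c' by rewrite divr_gt0.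
have : \forall x \near e, forall i j, `|Jac f e i j -
    'D_(delta_mx j 0) (fun x => f x i 0) x| <= c'.
  apply: (filter_forall (nbhs_filter e)) => i.
  apply: (filter_forall (nbhs_filter e)) => j; rewrite JE.
  by have /(@cvgrPdist_le _ _ _ (nbhs e)) := fc i j; apply.
move=> /(nbhs_ballP e)[r /= r0 re].
exists (r / 2) => [|x y xr yr]; first by rewrite divr_gt0//.
apply: normr_col_le => [|i]; first by rewrite mulr_ge0// ltW.
pose h (z : 'cV[R]_n) := f z i 0 - (Jac f e *m z) i 0.
have hd z j : is_derive z (delta_mx j 0) h
    ('D_(delta_mx j 0) (fun x => f x i 0) z - Jac f e i j).
  by apply: is_deriveB; [exact: derivableP|exact: is_derive_mulmx].
have -> : (f x - f y - Jac f e *m (x - y)) i 0 = h x - h y.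
  by rewrite mulmxBr /h !mxE; ring.
apply: le_trans.
  apply: (@mean_value_box n h e (r / 2) c') => //.
  move=> z j zr; have -> := @derive_val _ _ _ _ _ _ _ (hd z j); rewrite distrC re//.
  rewrite -ball_normE /ball_ /= distrC (le_lt_trans zr)// ltr_pdivrMr//.
  by rewrite ltr_pMr// ltr1n.
rewrite ler_wpM2r// /c' mulrCA ler_piMr ?(ltW c0)// ler_pdivrMr// mul1r ler_nat//.
Qed.

End MeanValue.

(** * Zeros of a perturbed vector field *)

Section PerturbedZeros.
Context {R : realType} {n : nat}.
Implicit Types (f g : 'cV[R]_n -> 'cV[R]_n) (e x y : 'cV[R]_n) (B : 'M[R]_n).

(* [|g x - x|] attains its minimum on the compact ball, and [g] halves it. *)
Lemma fixpoint_in_ball g e (r : R) :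
  continuous g -> 0 <= r ->
  (forall x, `|x - e| <= r -> `|g x - e| <= r) ->
  (forall x y, `|x - e| <= r -> `|y - e| <= r ->
    `|g x - g y| <= 2^-1 * `|x - y|) ->
  exists2 x, `|x - e| <= r & g x = x.
Proof.
move=> gc r0 gr gl.
have [||c + cmin] := @compact_EVT_min _ R (fun x => `|g x - x|) _ _
    (@compact_col_ball R n e r) _.
- by exists e; rewrite /= subrr normr0.
- apply: continuous_subspaceT => x.
  apply: (cvg_norm (F := nbhs x)).
  by apply: (cvgB (F := nbhs x)); [exact: gc|exact: cvg_id].
rewrite inE /= => cr; exists c => //.
have := cmin (g c); rewrite inE /= => /(_ (gr _ cr)).
move=> /le_trans /(_ (gl _ _ (gr _ cr) cr)) h.
by apply/eqP; rewrite -subr_eq0 -normr_le0; lra.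
Qed.

(** Newton's map with the Jacobian frozen at [e] is a contraction of the ball, and its fixed points
    are the zeros sought. The radius [r] stays free below [r0], and only then is [eps1] chosen,
    because [r] must later be adapted to the blocks. *)
Lemma unique_zero_nearby f e B :
  continuous f -> f e = 0 -> Jac f e \in unitmx ->
  (forall c : R, 0 < c -> exists2 r, 0 < r &
    forall x y, `|x - e| <= r -> `|y - e| <= r ->
      `|f x - f y - Jac f e *m (x - y)| <= c * `|x - y|) ->
  exists2 r0 : R, 0 < r0 & forall r, 0 < r <= r0 ->
  exists2 eps1 : R, 0 < eps1 & forall eps, 0 <= eps < eps1 ->
  exists x, [/\ `|x - e| <= r, f x + eps *: (B *m x) = 0 &
    forall y, `|y - e| <= r -> f y + eps *: (B *m y) = 0 -> y = x].
Proof.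
move=> fc fe0 Ju fJ; set J := Jac f e in Ju fJ.
have [K K0 PK] := mulmx_norm_bound (invmx J).
have [L L0 PL] := mulmx_norm_bound (invmx J *m B).
(* After multiplication by [invmx J], of norm at most [K], the nonlinear remainder is Lipschitz with
   constant 1/4. *)
have [|r0 r00 fr0] := fJ (K^-1 / 4); first by rewrite divr_gt0// invr_gt0.
exists r0 => // r /andP[r_gt0 rr0].
have s0 : 0 < 2 * r^-1 * `|e| + 4 :> R.
  by rewrite ltr_wpDl// !mulr_ge0// invr_ge0 ltW.
(* This one bound gives both [eps * L <= 1/4], so that the perturbation adds at most 1/4 to the
   Lipschitz constant, and [eps * L * |e| <= r / 2], so that [g] moves the centre by at most
   [r / 2]. *)
exists (L^-1 / (2 * r^-1 * `|e| + 4)) => [|eps /andP[eps0 epslt]].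
  by rewrite divr_gt0// invr_gt0.
have epsL : eps * L * (2 * r^-1 * `|e| + 4) < 1.
  by move: epslt; rewrite ltr_pdivlMr// -[L^-1]mul1r ltr_pdivlMr// mulrAC.
have epsL0 : 0 <= eps * L by rewrite mulr_ge0// ltW.
have epsL4 : eps * L <= 4^-1.
  have : 0 <= eps * L * (2 * r^-1 * `|e|) by rewrite mulr_ge0// !mulr_ge0// invr_ge0 ltW.
  by move: epsL; rewrite mulrDr; lra.
have epsLe : eps * L * `|e| <= 2^-1 * r.
  have : eps * L * `|e| * r^-1 <= 2^-1.
    by move: epsL; rewrite mulrDr; lra.
  by rewrite ler_pdivrMr.
pose g x := x - invmx J *m (f x + eps *: (B *m x)).
have gz x : (g x = x) <-> (f x + eps *: (B *m x) = 0).
  split=> [/eqP|fx]; last by rewrite /g fx mulmx0 subr0.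
  rewrite /g -subr_eq0 addrAC subrr add0r oppr_eq0 => /eqP.
  by move/(congr1 (mulmx J)); rewrite mulmx0 mulKVmx.
have gl x y : `|x - e| <= r -> `|y - e| <= r -> `|g x - g y| <= 2^-1 * `|x - y|.
  move=> xr yr.
  have -> : g x - g y = - (invmx J *m (f x - f y - J *m (x - y))) -
      eps *: (invmx J *m B *m (x - y)).
    rewrite /g !mulmxBr !mulmxDr mulKmx// mulKmx// -!scalemxAr !mulmxA scalerBr.
    by apply/colP => i; rewrite !mxE; ring.
  rewrite (le_trans (ler_normB _ _))// normrN normrZ (ger0_norm eps0).
  have h1 := PK (f x - f y - J *m (x - y)).
  have h2 := fr0 x y (le_trans xr rr0) (le_trans yr rr0).
  have {}h2 : K * `|f x - f y - J *m (x - y)| <= 4^-1 * `|x - y|.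
    by rewrite -ler_pdivlMl// (le_trans h2)// mulrA.
  have h3 : eps * `|invmx J *m B *m (x - y)| <= eps * L * `|x - y|.
    by rewrite -mulrA ler_wpM2l.
  have h4 : eps * L * `|x - y| <= 4^-1 * `|x - y| by rewrite ler_wpM2r.
  by lra.
(* The contraction brings [g x] within [r / 2] of [g e], which is itself within [r / 2] of [e]. *)
have ge x : `|x - e| <= r -> `|g x - e| <= r.
  move=> xr; rewrite -(subrKA (g e)) (le_trans (ler_normD _ _))//.
  have h1 := gl x e xr; rewrite subrr normr0 in h1.
  have {}h1 := h1 (ltW r_gt0).
  have -> : g e - e = - (eps *: (invmx J *m B *m e)).
    by rewrite /g fe0 add0r addrAC subrr add0r -scalemxAr mulmxA.
  rewrite normrN normrZ (ger0_norm eps0).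
  have h2 : eps * `|invmx J *m B *m e| <= eps * L * `|e|.
    by rewrite -mulrA ler_wpM2l.
  by lra.
have gc : continuous g.
  move=> x; apply: (cvgB (F := nbhs x)); first exact: cvg_id.
  apply: (continuous_comp (f := fun x => f x + eps *: (B *m x))); last first.
    exact: mulmx_continuous.
  apply: (cvgD (F := nbhs x)); first exact: fc.
  apply: (cvgZr (F := nbhs x)); exact: mulmx_continuous.
have [x xr gx] := fixpoint_in_ball gc (ltW r_gt0) ge gl.
exists x; split=> //; first exact/gz.
move=> y yr /gz gy; have := gl y x yr xr; rewrite gx gy => h.
by apply/eqP; rewrite -subr_eq0 -normr_le0; lra.
Qed.

Lemma dot_self_ge x i : x i 0 ^+ 2 <= dot x x.
Proof.
rewrite /dot (bigD1 i)//= -expr2 lerDl sumr_ge0// => j _.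
by rewrite -expr2 sqr_ge0.
Qed.

Lemma dot_self_ge0 x : 0 <= dot x x.
Proof. by rewrite sumr_ge0// => i _; rewrite -expr2 sqr_ge0. Qed.

Lemma sqr_enorm x : enorm x ^+ 2 = dot x x.
Proof. by rewrite sqr_sqrtr// dot_self_ge0. Qed.

(** Coercivity is a Euclidean hypothesis while compactness and the local analysis use the sup norm;
    this inequality links them. *)
Lemma normr_le_enorm x : `|x| <= enorm x.
Proof.
apply: normr_col_le => [|i]; first exact: sqrtr_ge0.
by rewrite -sqrtr_sqr ler_wsqrtr// dot_self_ge.
Qed.

Lemma dot_mulmx_le B : exists2 K : R, 0 <= K & forall x, dot (B *m x) x <= K * enorm x ^+ 2.
Proof.
have [K K0 BK] := mulmx_norm_bound B.
exists (n%:R * K); first by rewrite mulr_ge0// ltW.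
move=> x; apply: (@le_trans _ _ (\sum_(i < n) K * enorm x ^+ 2)).
  apply: ler_sum => i _; apply: le_trans (ler_norm _) _.
  rewrite normrM expr2 mulrA ler_pM//.
    rewrite (le_trans (normr_coord _ _))// (le_trans (BK x))// ler_wpM2l ?(ltW K0)//.
    exact: normr_le_enorm.
  by rewrite (le_trans (normr_coord _ _))// normr_le_enorm.
by rewrite sumr_const card_ord -[_ *+ n]mulr_natl mulrA.
Qed.

(** At a zero, [f x] equals [- eps *: (B *m x)]. Coercivity forbids this for [enorm x >= R0]. Closer
    to the origin but away from the zeros of [f], compactness bounds [|f x|] below by some [m > 0],
    which a small [eps] cannot reach. *)
Lemma zeros_near f B (R0 CF : R) :
  continuous f -> 0 < R0 -> 0 < CF ->
  (forall x, R0 <= enorm x -> CF * enorm x ^+ 2 <= - dot (f x) x) ->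
  forall r, 0 < r -> exists2 eps1 : R, 0 < eps1 &
  forall eps x, 0 <= eps < eps1 -> f x + eps *: (B *m x) = 0 ->
    exists2 e, f e = 0 & `|x - e| <= r.
Proof.
move=> fc R00 CF0 coer r r0.
have [K K0 BK] := dot_mulmx_le B.
have [L L0 BL] := mulmx_norm_bound B.
(* The condition [r <= |x - e|] is written with opposite signs so that it is a closed sublevel
   condition. *)
pose A := [set x | `|x| <= R0 /\ forall e, f e = 0 -> - `|x - e| <= - r].
have Acl : closed A.
  have -> : A = [set x | `|x| <= R0] `&`
      \bigcap_(e in [set e | f e = 0]) [set x | - `|x - e| <= - r].
    by [].
  apply: closedI; first by apply: closed_le_fun; exact: norm_continuous.
  apply: closed_bigI => e _; apply: closed_le_fun => x.
  apply: (cvgN (F := nbhs x)); apply: (cvg_norm (F := nbhs x)).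
  by apply: (cvgB (F := nbhs x)); [exact: cvg_id|exact: cvg_cst].
have Aco : compact A by apply: (@compact_col _ _ _ R0 Acl) => x [].
have [m m0 fm] : exists2 m : R, 0 < m & forall x, A x -> m <= `|f x|.
  have [A0|/set0P A0] := eqVneq A set0; first by exists 1 => // x; rewrite A0.
  have [|c + cmin] := @compact_EVT_min _ R (fun x => `|f x|) _ A0 Aco _.
    by apply: continuous_subspaceT => x; apply: (cvg_norm (F := nbhs x)); exact: fc.
  rewrite inE => -[_ cr]; exists `|f c| => [|x Ax]; last by rewrite cmin// inE.
  (* If [f] vanished at the minimiser [c], membership in [A] would put [c] at distance at least [r]
     from itself. *)
  rewrite normr_gt0; apply/eqP => /cr; rewrite subrr normr0; lra.
have K1 : 0 < K + 1 by lra.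
have d1 : 0 < CF / (K + 1) by rewrite divr_gt0.
have d2 : 0 < m / (L * R0) by rewrite divr_gt0// mulr_gt0.
(* The first bound rules out [R0 <= enorm x]; the second makes the perturbation smaller than [m] on
   the remaining ball. The constant [K] may be 0, hence [K + 1]. *)
exists (Num.min (CF / (K + 1)) (m / (L * R0))); first by rewrite lt_min d1.
move=> eps x /andP[eps0]; rewrite lt_min => /andP[eps1 eps2] /eqP.
rewrite addr_eq0 => /eqP fx.
have xR0 : enorm x < R0.
  rewrite ltNge; apply/negP => R0x; have := coer x R0x.
  have -> : - dot (f x) x = eps * dot (B *m x) x.
    rewrite fx /dot mulr_sumr -sumrN; apply: eq_bigr => i _.
    by rewrite !mxE mulNr opprK mulrA.
  move=> h1; have h2 : eps * dot (B *m x) x <= eps * (K * enorm x ^+ 2).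
    by rewrite ler_wpM2l.
  have x0 : 0 < enorm x ^+ 2 by rewrite exprn_gt0// (lt_le_trans R00).
  have : CF <= eps * K by rewrite -(ler_pM2r x0) -mulrA (le_trans h1).
  by move: eps1; rewrite ltr_pdivlMr// mulrDr mulr1; lra.
apply: contrapT => noe.
have Ax : A x.
  split=> [|e fe0]; first by rewrite (le_trans (normr_le_enorm x))// ltW.
  by rewrite lerN2 leNgt; apply/negP => /ltW xe; apply: noe; exists e.
have := fm x Ax; rewrite fx normrN normrZ (ger0_norm eps0) leNgt => /negP; apply.
move: eps2; rewrite ltr_pdivlMr ?mulr_gt0//; apply: le_lt_trans.
rewrite ler_wpM2l// (le_trans (BL x))// ler_wpM2l ?(ltW L0)//.
by rewrite (le_trans (normr_le_enorm x))// ltW.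
Qed.

End PerturbedZeros.

(** * Isolating blocks with cones *)

Section Blocks.
Context {R : realType}.

Lemma hbox_closed n1 n2 (a : 'I_n1 -> R) (b : 'I_n2 -> R) : closed (hbox a b).
Proof.
have -> : hbox a b =
    (\bigcap_k [set z : 'cV[R]_(n1 + (n2 + n2)) |
       `|z (lshift (n2 + n2) k) 0| <= a k]) `&`
    (\bigcap_k [set z : 'cV[R]_(n1 + (n2 + n2)) |
       Num.sqrt (z (rshift n1 (lshift n2 k)) 0 ^+ 2 +
                 z (rshift n1 (rshift n2 k)) 0 ^+ 2) <= b k]).
  apply/seteqP; split=> z [za zb]; split=> // k; [| |exact: za|exact: zb] => _.
    exact: za.
  exact: zb.
apply: closedI; apply: closed_bigI => k _; apply: closed_le_fun => z.
  by apply: (cvg_norm (F := nbhs z)); exact: coord_continuous.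
have sq j : (fun z : 'cV[R]_(n1 + (n2 + n2)) => z j 0 ^+ 2) @ z --> z j 0 ^+ 2.
  by apply: (cvgM (F := nbhs z)); exact: coord_continuous.
exact: (continuous_comp (cvgD (FF := nbhs_filter z) (sq _) (sq _)) (@sqrt_continuous R _)).
Qed.

(** Since [Lambda] is bijective, the block is also the preimage of two closed boxes under the
    continuous maps [P_u] and [P_s]. Closedness is what keeps a whole ball around an outside point
    off the block. *)
Lemma hset_set_closed d (H : @hset R d) : closed (hset_set H).
Proof.
have -> : hset_set H = @P_u R d H @^-1` @N_u R d H `&`
                       @P_s R d H @^-1` @N_s R d H.
  apply/seteqP; split=> [x [p [q [Np Nq ->]]]|x [Nu Ns]].
    by rewrite /= /P_u /P_s /Lambda addrK mulmxA hLK mul1mx col_mxKu col_mxKd.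
  exists (P_u H x), (P_s H x); split=> //.
  by rewrite /Lambda vsubmxK mulmxA hLinvK mul1mx subrK.
have [K K0 HK] := mulmx_norm_bound (hLinv H).
have Pl x y : hLinv H *m (x - hc H) - hLinv H *m (y - hc H) = hLinv H *m (x - y).
  by rewrite -mulmxBr opprB addrA subrK.
apply: closedI.
  apply: preimage_closed; last exact: hbox_closed.
  move=> x _; apply: (lipschitz_continuous K0) => {}x y.
  rewrite /P_u -raddfB/= Pl (le_trans _ (HK _))//.
  by apply: normr_col_le => // i; rewrite mxE normr_coord.
apply: preimage_closed; last exact: hbox_closed.
move=> x _; apply: (lipschitz_continuous K0) => {}x y.
rewrite /P_s -raddfB/= Pl (le_trans _ (HK _))//.
by apply: normr_col_le => // i; rewrite mxE normr_coord.
Qed.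

Lemma deriv_within_cst (V : normedModType R) (D : set R) (e : V) (t : R) :
  deriv_within D (fun=> e) t 0.
Proof.
rewrite /deriv_within; under eq_fun do rewrite subrr scaler0.
exact: cvg_cst.
Qed.

(** Two distinct equilibria give two constant trajectories in the block, along which the cone
    function is constant instead of strictly increasing. *)
Lemma block_equilibrium_unique d (H : @hset R d) (f : 'cV[R]_d -> 'cV[R]_d) e1 e2 :
  satisfies_cones H f -> f e1 = 0 -> f e2 = 0 ->
  hset_set H e1 -> hset_set H e2 -> e1 = e2.
Proof.
move=> [alpha [beta [_ _ cones]]] f1 f2 H1 H2; apply: contrapT => e12.
have cst e : f e = 0 -> trajectory halfline f (fun=> e).
  by move=> fe t _; rewrite fe; exact: deriv_within_cst.
by have := cones _ _ (cst _ f1) (cst _ f2) e12 0 1 (lexx _) ltr01;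
   rewrite ltxx => /(_ (fun _ _ => conj H1 H2)).
Qed.

End Blocks.

(** * Equilibria of the semiflow with memory *)

Section Equilibria.
Context {R : realType}.

Let aeF := ae_filter_ringOfSetsType (@lebesgue_measure R).

(** A nonempty open interval has positive measure, so it cannot lie in a null set. *)
Lemma ae_point_itv (P : R -> Prop) (a b : R) : a < b ->
  {ae @lebesgue_measure R, forall s, P s} -> exists2 s, a < s < b & P s.
Proof.
move=> ab [N [mN N0 PN]]; apply: contrapT => noP.
have abN : `]a, b[ `<=` N.
  move=> s; rewrite /= in_itv /= => sab; apply: PN => Ps; apply: noP.
  by exists s.
have := @subset_measure0 _ _ _ (@lebesgue_measure R) _ _ (measurable_itv `]a, b[) mN abN N0.
rewrite /= lebesgue_measure_itv /= lte_fin ab -EFinD => /eqP.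
by rewrite eqe subr_eq0 gt_eqF.
Qed.

Lemma deriv_within_dist (V : normedModType R) (D : set R) (z : R -> V) (t : R)
    (v : V) :
  deriv_within D z t v -> forall e : R, 0 < e ->
  exists2 r, 0 < r & forall s, D s -> s != t -> `|s - t| < r ->
    `|v - (s - t)^-1 *: (z s - z t)| <= e.
Proof.
move=> /cvgrPdist_le zv e e0; have [r /= r0 zr] := zv e e0.
by exists r => // s Ds st sr; apply: zr => //=; rewrite distrC.
Qed.

Lemma deriv_within_continuous (V : normedModType R) (D : set R) (z : R -> V)
    (t : R) (v : V) :
  deriv_within D z t v -> forall e : R, 0 < e ->
  exists2 r, 0 < r & forall s, D s -> `|s - t| < r -> `|z s - z t| <= e.
Proof.
(* Near [t] the difference quotient is bounded by [|v| + 1], which gives a Lipschitz bound at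
   [t]. *)
move=> /deriv_within_dist/(_ _ ltr01)[r r0 zr] e e0.
have v1 : 0 < `|v| + 1 by rewrite ltr_wpDl.
exists (Num.min r (e / (`|v| + 1))) => [|s Ds]; first by rewrite lt_min r0 divr_gt0.
rewrite lt_min => /andP[sr se].
have [->|st] := eqVneq s t; first by rewrite subrr normr0 ltW.
set q := (s - t)^-1 *: (z s - z t).
have qv : `|q| <= `|v| + 1.
  have := zr s Ds st sr; rewrite -/q => vq.
  have := ler_normB v (v - q); rewrite subKr; lra.
have -> : z s - z t = (s - t) *: q.
  by rewrite /q scalerA divff ?scale1r// subr_eq0.
rewrite normrZ; apply: (@le_trans _ _ (e / (`|v| + 1) * (`|v| + 1))).
  by rewrite ler_pM// ltW.
by rewrite divfK// gt_eqF.
Qed.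

Context {d : nat}.
Implicit Types (f : 'cV[R]_d -> 'cV[R]_d) (A M : R -> 'M[R]_d) (x : R -> 'cV[R]_d)
  (p : @state R d).

Lemma L2A_cst0 A : L2A A (fun=> 0).
Proof.
split=> [i j|]; first by under eq_fun do rewrite mxE; exact: measurable_cst.
rewrite integral0_eq ?ltry// => s _.
by rewrite mulmx0 /dot big1// => i _; rewrite mxE mul0r.
Qed.

Lemma L2A_norm_cst0 A : L2A_norm A (fun=> 0) = 0.
Proof.
rewrite /L2A_norm /Rintegral integral0_eq ?sqrtr0// => s _.
by rewrite mulmx0 /dot big1// => i _; rewrite mxE mul0r.
Qed.

Lemma mxint_cst0 m n : mxint (fun=> 0 : 'M[R]_(m, n)) = 0.
Proof.
by apply/matrixP => i j; rewrite !mxE /Rintegral integral0_eq.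
Qed.

(** The constant solution keeps a zero history at all times, so the memory integral vanishes and the
    equation reduces to the hypothesis. *)
Lemma zero_history_equilibrium f A M (eps : R) (e : 'cV[R]_d) :
  f e + eps *: (mxint M *m e) = 0 ->
  memory_equilibrium f A M eps (zero_history e).
Proof.
move=> fe; split=> [|t t0]; first exact: L2A_cst0.
have h0 u s : history (zero_history e) (fun=> e) u s = 0.
  by rewrite /history /=; case: ifP => _; rewrite ?addr0 subrr.
exists (fun=> e); split; last first.
  by split=> //=; apply: (aeW (@lebesgue_measure R)) => s _; rewrite h0.
split=> // u _.
have -> : (fun s => M s *m history (zero_history e) (fun=> e) u s) = fun=> 0.
  by apply/funext => s; rewrite h0 mulmx0.
by rewrite mxint_cst0 scaler0 addr0 fe; exact: deriv_within_cst.
Qed.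

Lemma mxint_ae0 M (eta : R -> 'cV[R]_d) :
  mxmeasurable M -> mxmeasurable eta ->
  {ae @lebesgue_measure R, forall s, 0 <= s -> eta s = 0} ->
  mxint (fun s => M s *m eta s) = 0.
Proof.
move=> mM meta eta0; apply/matrixP => i j; rewrite !mxE /Rintegral.
rewrite (ae_eq_integral (cst 0))//; first by rewrite integral0.
- exact: measurable_itv.
- apply/measurable_EFinP; under eq_fun do rewrite mxE.
  apply: measurable_sum => k; apply: measurable_funM; [exact: mM|exact: meta].
apply: (filterS (Filter := aeF)) eta0 => s h; rewrite /halfline /= in_itv /= andbT => s0.
by rewrite h// mulmx0 mxE.
Qed.

(* Read at horizon t, the fixed-point equation says that [eta s = x_t (t - s) - x0]
   for almost every [s <= t]. Comparing the horizons T and t <= T as s -> t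
   gives [x_T (T - t) = x_t 0 = x0]: every solution involved is constant. *)
Lemma memory_equilibrium_constant f A M (eps : R) p (T : R) x :
  memory_equilibrium f A M eps p -> 0 < T ->
  memory_solution f M eps p x -> state_eq p (history p x T, x T) ->
  forall t, 0 <= t <= T -> x t = p.2.
Proof.
move=> [_ eqp] T0 [x0 xd] [aeT xT] t /andP[t0 tT].
have [->//|tNT] := eqVneq t T; have [->//|tN0] := eqVneq t 0.
(* The horizon to compare with [T]: as [s] increases to [u], [T - s] tends to [t] and [u - s] tends
   to 0. *)
pose u := T - t.
have u0 : 0 < u by rewrite subr_gt0 lt_neqAle tNT.
have [y [[y0 yd] [aeu yu]]] := eqp u (ltW u0).
apply/eqP; rewrite -subr_eq0 -normr_le0; apply/ler_addgt0Pl => e e0.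
rewrite addr0.
have e2 : 0 < e / 2 by rewrite divr_gt0.
have [r1 r10 xr] := deriv_within_continuous (xd t t0) e2.
have [r2 r20 yr] := deriv_within_continuous (yd 0 (lexx _)) e2.
(* The bound by [u] keeps the sample point [s] nonnegative; the other two serve continuity of [x] at
   [t] and of [y] at 0. *)
pose r := Num.min u (Num.min r1 r2).
have r0 : 0 < r by rewrite !lt_min u0 r10 r20.
have [||s /andP[us su] [sT sU]] := @ae_point_itv (fun s =>
    (0 <= s -> p.1 s = history p x T s) /\ (0 <= s -> p.1 s = history p y u s))
    (u - r) u.
- by rewrite ltrBlDr ltrDl.
- by apply: (@filterS2 _ _ aeF) aeT aeu => s.
have [ru r1r r2r] : [/\ r <= u, r <= r1 & r <= r2].
  by split; rewrite /r !ge_min lexx ?orbT.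
have s0 : 0 <= s by lra.
have := sT s0; rewrite (sU s0) /history (ltW su).
rewrite ifT; last by rewrite /u in su *; lra.
(* Both solutions end at [p.2], so the subtracted end values cancel and leave
   [y (u - s) = x (T - s)]. *)
rewrite /= in xT yu; rewrite -xT -yu => /addIr yx.
have h1 : `|x (T - s) - x t| <= e / 2.
  apply: xr; rewrite /halfline /= ?in_itv /= ?andbT; first by rewrite /u in su; lra.
  by rewrite ltr_norml /u in us su ru *; lra.
have h2 : `|y (u - s) - y 0| <= e / 2.
  apply: yr; rewrite /halfline /= ?in_itv /= ?andbT; first by lra.
  by rewrite subr0 ltr_norml; lra.
rewrite -y0 -(subrKA (x (T - s))) (le_trans (ler_normD _ _))// (splitr e).
by rewrite lerD//; [rewrite distrC|rewrite -yx].
Qed.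

(** Constancy of the solution on each horizon [n.+1] kills the history on [[0, n.+1]] up to a null
    set, and countably many such sets suffice. The stationary equation is then the differential
    equation at time 0, where the derivative of a constant solution is 0. *)
Lemma memory_equilibrium_eq f A M (eps : R) p :
  mxmeasurable M -> memory_equilibrium f A M eps p ->
  state_eq p (zero_history p.2) /\ f p.2 + eps *: (mxint M *m p.2) = 0.
Proof.
move=> mM ep; have [[meta _] eqp] := ep.
have eta0 : {ae @lebesgue_measure R, forall s, 0 <= s -> p.1 s = 0}.
  have : {ae @lebesgue_measure R, forall s, forall n : nat,
      0 <= s <= n.+1%:R -> p.1 s = 0}.
    apply: ae_foralln => n.
    have [x [xs xq]] := eqp n.+1%:R (ler0n _ _).
    have cst := memory_equilibrium_constant ep (ltr0Sn _ _) xs xq.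
    apply: (filterS (Filter := aeF)) xq.1 => s sq /andP[s0 sn].
    by rewrite sq// /history /= sn !cst ?subrr ?ler0n ?lexx// subr_ge0 sn gerBl.
  apply: (filterS (Filter := aeF)) => s sn s0; apply: (sn (Num.bound s)); rewrite s0 /=.
  by rewrite (le_trans (ltW (archi_boundP s0)))// ler_nat.
split; first by split.
have [x [xs xq]] := eqp 1 ler01.
have cst := memory_equilibrium_constant ep ltr01 xs xq.
have [x0 /(_ 0 (lexx _))] := xs.
rewrite x0; set v := mxint (fun s => _ *m _).
have -> : v = 0.
  apply: mxint_ae0 => //; last first.
    apply: (filterS (Filter := aeF)) eta0 => s h s0; rewrite /history.
    case: ifP => [s0'|_]; last by rewrite subr0 h// addr0 x0 subrr.
    by rewrite (_ : s = 0) ?subr0 ?subrr//; apply/eqP; rewrite eq_le s0 s0'.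
  move=> i j; rewrite (_ : (fun s => _) = fun s =>
      if s <= 0 then (x (- s) - x 0) i j else p.1 s i j); last first.
    apply/funext => s; rewrite /history sub0r subr0 x0; case: ifP => // _.
    by rewrite addrAC subrr add0r.
  (* On the half-line the first branch concerns only [s = 0], where it gives 0; an indicator
     therefore replaces the case distinction. *)
  apply: (eq_measurable_fun (fun s => \1_(`]0, +oo[%classic : set R) s * p.1 s i j)).
    move=> s; rewrite inE /halfline /= in_itv /= andbT => s0.
    rewrite indicE; case: ifP => s0'.
      have -> : s = 0 by apply/eqP; rewrite eq_le s0 s0'.
      by rewrite memNset ?mul0r ?oppr0 ?subrr ?mxE// /= in_itv /= ltxx.
    by rewrite mem_set ?mul1r// /= in_itv /= andbT ltNge s0'.
  apply: measurable_funM; last exact: meta.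
  exact: measurable_indic.
rewrite scaler0 addr0 => /deriv_within_dist dx.
apply/eqP; rewrite -normr_le0; apply/ler_addgt0Pl => e e0; rewrite addr0.
have [r r0 xr] := dx e e0.
(* A positive time below [r], where the quotient approximates the derivative, and below 1, where [x]
   is known to be constant. *)
pose s := Num.min r 1 / 2.
have m0 : 0 < Num.min r 1 :> R by rewrite lt_min r0 ltr01.
have s0 : 0 < s by rewrite divr_gt0.
have sm : s < Num.min r 1 by rewrite ltr_pdivrMr// ltr_pMr// ltr1n.
move: sm; rewrite lt_min => /andP[sr s1].
have xsE : x s = p.2 by apply: cst; rewrite !ltW.
have := xr s; rewrite xsE x0 subrr scaler0 !subr0; apply.
- by rewrite /halfline /= in_itv /= ltW.
- by rewrite gt_eqF.
by rewrite gtr0_norm.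
Qed.

End Equilibria.

(** * Equilibria under a small perturbation *)

(** A real null vector of a singular Jacobian makes 0 a complex eigenvalue, on the imaginary
    axis. *)
Lemma hyperbolic_unitmx (R : realType) d (f : 'cV[R]_d -> 'cV[R]_d) (e : 'cV[R]_d) :
  hyperbolic f e -> Jac f e \in unitmx.
Proof.
move=> hyp; rewrite unitmxE unitfE; apply/negP => /det0P[v v0 vJ].
suff /hyp : eigenvalue (map_mx (real_complex R) (Jac f e)) 0 by [].
apply/eigenvalueP; exists (map_mx (real_complex R) v).
  by rewrite -map_mxM vJ map_mx0 scale0r.
by rewrite map_mx_eq0.
Qed.

(** Takes a minimum over a finite set; it serves to make radii and thresholds common to all
    equilibria. *)
Lemma finite_uniform_bound (R : realType) (T : eqType) (S : set T) (P : T -> R -> Prop) :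
  finite_set S ->
  (forall e r r', 0 < r' <= r -> P e r -> P e r') ->
  (forall e, S e -> exists2 r, 0 < r & P e r) ->
  exists2 r, 0 < r & forall e, S e -> P e r.
Proof.
move=> /finite_seqP[s ->] Pdown; elim: s => [|e s IH] Ps; first by exists 1.
have [|r1 r10 Pr1] := IH; first by move=> u us; apply: Ps; rewrite /= in_cons us orbT.
have [|r2 r20 Pr2] := Ps e; first by rewrite /= mem_head.
exists (Num.min r1 r2) => [|u /=]; first by rewrite lt_min r10.
have r120 : 0 < Num.min r1 r2 by rewrite lt_min r10.
rewrite in_cons => /orP[/eqP->|us].
  by apply: Pdown Pr2; rewrite r120 ge_min lexx orbT.
by apply: Pdown (Pr1 u us); rewrite r120 ge_min lexx.
Qed.

(** The sets [N e] are fixed before [eps0], so the threshold may depend on the blocks. *)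
Theorem theorem5p1 (R : realType) (d : nat) (F : 'cV[R]_d -> R)
    (A M : R -> 'M[R]_d) (CA DA DM : R)
    (N : 'cV[R]_d -> set 'cV[R]_d) :
  Ck 3 F ->
  (exists R0 CF : R, [/\ 0 < R0, 0 < CF &
     forall x, R0 <= enorm x -> CF * enorm x ^+ 2 <= - dot (grad F x) x]) ->
  finite_set [set e | grad F e = 0] ->
  (forall e, grad F e = 0 -> hyperbolic (grad F) e) ->
  (forall e1 e2, grad F e1 = 0 -> grad F e2 = 0 ->
     meet_transversally (unstable_manifold (grad F) e1)
                        (stable_manifold (grad F) e2)) ->
  C1_halfline A ->
  (forall s, 0 <= s -> posdef (A s)) ->
  mxmeasurable M ->
  0 < CA -> 0 < DA -> 0 < DM ->
  {ae @lebesgue_measure R, forall s, 0 < s -> forall u : 'cV[R]_d,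
     dot (derive1 A s *m u) u <= - CA * dot (A s *m u) u} ->
  (forall s, 0 <= s -> lambda_max (A s) <= DA ^+ 2 * lambda_min (A s)) ->
  (forall s, 0 <= s -> opnorm (M s) <= DM ^+ 2 * lambda_min (A s)) ->
  (mxint M)^T = mxint M ->
  exists eps0 rad : R, [/\ 0 < eps0, 0 < rad &
    forall eps, 0 <= eps < eps0 ->
    exists eeps : 'cV[R]_d -> 'cV[R]_d,
    [/\ (forall e, grad F e = 0 ->
           isolating_block_with_cones (grad F) e (N e) ->
           [/\ memory_equilibrium (grad F) A M eps (zero_history (eeps e)),
               ball_times A rad (N e) (zero_history (eeps e)) &
               forall p, memory_equilibrium (grad F) A M eps p ->
                 ball_times A rad (N e) p -> state_eq p (zero_history (eeps e))]),
        (forall e, grad F e = 0 ->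
           memory_equilibrium (grad F) A M eps (zero_history (eeps e))) &
        (forall p, memory_equilibrium (grad F) A M eps p ->
           exists2 e, grad F e = 0 & state_eq p (zero_history (eeps e)))]].
Proof.
move=> [_ F3] [R0 [CF [R00 CF0 coer]]] Zfin hyp _ _ _ mM _ _ _ _ _ _ _.
set f := grad F in coer Zfin hyp *; pose Z := [set e | f e = 0].
have fE i : (fun x => f x i 0) = 'D_(delta_mx i 0) F.
  by apply/funext => x; rewrite /f mxE.
have fd i j x : derivable (fun x => f x i 0) x (delta_mx j 0).
  by rewrite fE; have [_ [_ /(_ j)[]]] := F3 i.
have fdc i j : continuous ('D_(delta_mx j 0) (fun x => f x i 0)).
  by rewrite fE; have [_ [_ /(_ j)[_ []]]] := F3 i.
have fc : continuous f.
  move=> x; apply: (cvg_col (nbhs_filter x)) => i.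
  have -> : (fun y => f y i 0) @ nbhs x = 'D_(delta_mx i 0) F @ nbhs x by rewrite fE.
  by rewrite mxE; have [_ [+ _]] := F3 i; apply.
set B := mxint M.
(* A small ball around [e] lies in the block of [e], which has [e] in its interior, and misses every
   other block: these are closed and, by the cone condition, do not contain [e]. *)
have separated e : Z e -> exists2 r, 0 < r & forall x, `|x - e| <= r ->
    (isolating_block_with_cones f e (N e) -> N e x) /\
    forall e', Z e' -> isolating_block_with_cones f e' (N e') -> N e' x -> e' = e.
  move=> Ze.
  have [r1 r10 inN] : exists2 r, 0 < r &
      isolating_block_with_cones f e (N e) -> forall x, `|x - e| <= r -> N e x.
    have [[H [_ /(nbhs_ballP e)[r /= r0 rN] _ _]]|noB] :=
        pselect (isolating_block_with_cones f e (N e)); last by exists 1.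
    exists (r / 2) => [|_ x xr]; first by rewrite divr_gt0.
    apply: rN; rewrite -ball_normE /ball_ /= distrC (le_lt_trans xr)//.
    by rewrite ltr_pdivrMr// ltr_pMr// ltr1n.
  have [|e' Ze'|r2 r20 outN] := @finite_uniform_bound R _ Z (fun e' r =>
      isolating_block_with_cones f e' (N e') -> forall x, `|x - e| <= r ->
      N e' x -> e' = e) Zfin.
  - move=> e' r r' /andP[_ r'r] + Be' x xr; apply=> //.
    exact: le_trans r'r.
  - have [->|/eqP e'e] := eqVneq e' e; first by exists 1.
    have [[H [NE Ne' _ cones]]|noB] :=
        pselect (isolating_block_with_cones f e' (N e')); last by exists 1.
    have : nbhs e (~` N e').
      apply: open_nbhs_nbhs; split.
        by apply: closed_openC; rewrite NE; exact: hset_set_closed.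
      move=> Ne; apply: e'e; apply: (block_equilibrium_unique cones) => //.
        by rewrite -NE; exact: interior_subset.
      by rewrite -NE.
    move=> /(nbhs_ballP e)[r /= r0 rN].
    exists (r / 2) => [|_ x xr Nx]; first by rewrite divr_gt0.
    exfalso; apply: (rN x) => //.
    rewrite -ball_normE /ball_ /= distrC (le_lt_trans xr)//.
    by rewrite ltr_pdivrMr// ltr_pMr// ltr1n.
  exists (Num.min r1 r2) => [|x]; first by rewrite lt_min r10.
  rewrite le_min => /andP[xr1 xr2]; split=> [Be|e' Ze' Be'].
    exact: inN.
  exact: outN.
have [|r1 r10 sepr] := finite_uniform_bound Zfin _ separated.
  move=> e r r' /andP[_ r'r] sep x xr; apply: sep.
  exact: le_trans r'r.
pose unique_zero e r eps := exists x, [/\ `|x - e| <= r,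
  f x + eps *: (B *m x) = 0 &
  forall y, `|y - e| <= r -> f y + eps *: (B *m y) = 0 -> y = x].
have [||r2 r20 loc] := @finite_uniform_bound R _ Z (fun e r0 =>
    forall r, 0 < r <= r0 -> exists2 eps1 : R, 0 < eps1 &
    forall eps, 0 <= eps < eps1 -> unique_zero e r eps) Zfin.
- move=> e r r' /andP[_ r'r] h s /andP[s0 sr']; apply: h.
  by rewrite s0 (le_trans sr').
- move=> e Ze; apply: unique_zero_nearby => //; first exact/hyperbolic_unitmx/hyp.
  by move=> c c0; apply: strict_derivative => // i j; exact: fdc.
(* The common radius is fixed first, for separation and contraction together; both thresholds on
   [eps] are then chosen for this [r]. *)
pose r := Num.min r1 r2; have r0 : 0 < r by rewrite lt_min r10.
have [rr1 rr2] : r <= r1 /\ r <= r2 by rewrite !ge_min !lexx orbT.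
have [||eps1 eps10 solve] := @finite_uniform_bound R _ Z (fun e eps1 =>
    forall eps, 0 <= eps < eps1 -> unique_zero e r eps) Zfin.
- move=> e a a' /andP[_ a'a] h eps /andP[eps0 epsa']; apply: h.
  by rewrite eps0 (lt_le_trans epsa').
- by move=> e Ze; apply: loc => //; rewrite r0.
have [eps2 eps20 near] := zeros_near B fc R00 CF0 coer r0.
(* All equilibria have zero history, so any positive radius would do. *)
exists (Num.min eps1 eps2), 1; split=> //; first by rewrite lt_min eps10.
move=> eps /andP[eps0]; rewrite lt_min => /andP[epslt1 epslt2].
(* Away from the equilibria of [f], [eeps] takes the default value 0. *)
have /choice[eeps eepsP] e : exists x, Z e ->
    [/\ `|x - e| <= r, f x + eps *: (B *m x) = 0 &
        forall y, `|y - e| <= r -> f y + eps *: (B *m y) = 0 -> y = x].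
  have [Ze|nZe] := pselect (Z e); last by exists 0.
  by have [|x xP] := solve e Ze eps; [rewrite eps0|exists x].
have eqeeps e : Z e -> memory_equilibrium f A M eps (zero_history (eeps e)).
  by move=> /eepsP[_ ? _]; exact: zero_history_equilibrium.
exists eeps; split=> // [e Ze Be|p /memory_equilibrium_eq -/(_ mM)[p0 pf]].
  split=> [||p /memory_equilibrium_eq -/(_ mM)[p0 pf] [_ _ Np]]; first exact: eqeeps.
    split; [exact: L2A_cst0|by rewrite L2A_norm_cst0|].
    have [er _ _] := eepsP e Ze.
    by have [+ _] := sepr e Ze _ (le_trans er rr1); apply.
  (* The zero [p.2] is close to some equilibrium [e']; as it lies in the block of [e], separation
     forces [e' = e], and local uniqueness identifies it with [eeps e]. *)
  have [|e' Ze' e'r] := near eps p.2 _ pf; first by rewrite eps0.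
  have [_ /(_ e Ze Be Np) e'E] := sepr e' Ze' _ (le_trans e'r rr1).
  rewrite -e'E in e'r; have [_ _ uniq] := eepsP e Ze.
  by rewrite -(uniq _ e'r pf).
have [|e Ze er] := near eps p.2 _ pf; first by rewrite eps0.
exists e => //; have [_ _ uniq] := eepsP e Ze.
by rewrite -(uniq _ er pf).
Qed.
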